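(* Let $\mathcal G$ be a weighted directed graph on $n$ agents with Laplacian matrix $L=(L_{ij})$, and let $h>0$. Consider the multi-agent system with input saturation $$\dot x_i(t)=\mathrm{sat}_h(u_i(t)),\quad i=1,\dots,n,\ t\ge 0,$$ with states $x_i(t)\in\mathbb R^p$, under the distributed protocol $$u_i(t)=-\sum_{j=1}^n L_{ij}x_j(t).$$ Suppose that $\mathcal G$ has a directed spanning tree, and that the agents are ordered so that $L$ is written in the Perron–Frobenius (block upper triangular) form $$L=\begin{bmatrix}L^{1,1}&L^{1,2}&\cdots&L^{1,M}\\0&L^{2,2}&\cdots&L^{2,M}\\ \vdots&\vdots&\ddots&\vdots\\0&0&\cdots&L^{M,M}\end{bmatrix},$$ where $L^{m,m}$ is the $n_m\times n_m$ block associated with the $m$-th strongly connected component of $\mathcal G$, $m=1,\dots,M$. Then global consensus is achieved, i.e., for every initial condition $(x_1(0),\dots,x_n(0))\in(\mathbb R^p)^n$, $\lim_{t\to\infty}(x_i(t)-x_j(t))=0$ for all $i,j\in\{1,\dots,n\}$.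
   Context: Weighted digraph: $\mathcal G=(\mathcal V,\mathcal E,\mathcal A)$ with agents $\mathcal V=\{v_1,\dots,v_n\}$, links $\mathcal E\subseteq\mathcal V\times\mathcal V$, and weighted adjacency matrix $\mathcal A=(a_{ij})$ with $a_{ij}\ge 0$ and $a_{ii}=0$. One has $(v_i,v_j)\in\mathcal E\iff a_{ij}>0$, and this means there is a directed link from $v_j$ to $v_i$ (agent $v_j$ can send information to $v_i$). Laplacian: $L=D-\mathcal A$ with $D=\mathrm{diag}(\sum_j a_{1j},\dots,\sum_j a_{nj})$; that is, $L_{ij}=-a_{ij}$ for $i\ne j$ and $L_{ii}=\sum_{j}a_{ij}$. Directed spanning tree: $\mathcal G$ has a directed spanning tree if there exists an agent $v_{i_0}$ such that for any other agent $v_j$ there is a directed path from $v_{i_0}$ to $v_j$ (a sequence of distinct agents beginning with $v_{i_0}$ and ending with $v_j$ with a directed link from each agent to the next). The block form above can always be obtained by a proper permutation (relabeling) of the agents. Saturation function: for a constant $h>0$ and scalar $s$, $\mathrm{sat}_h(s)=h$ if $s\ge h$, $\mathrm{sat}_h(s)=s$ if $|s|<h$, $\mathrm{sat}_h(s)=-h$ if $s\le -h$; for vectors it is applied componentwise. *)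

(* Defs.v *)
From HB Require Import structures.
From mathcomp Require Import all_boot all_order all_algebra.
From mathcomp Require Import all_classical all_reals all_analysis.

Set Implicit Arguments.
Unset Strict Implicit.
Unset Printing Implicit Defensive.

Import Order.TTheory GRing.Theory Num.Theory.
Import numFieldNormedType.Exports.

Local Open Scope ring_scope.

(* The link set is determined by the weights, so a weighted digraph on the
   agents 'I_n is given by its adjacency matrix alone. *)
Definition weighted_digraph (R : realType) (n : nat) (A : 'M[R]_n) : Prop :=
  (forall i j, 0 <= A i j) /\ (forall i, A i i = 0).

(* Note the transposition: a_vu > 0 is a directed link from u to v. *)
Definition link (R : realType) (n : nat) (A : 'M[R]_n) : rel 'I_n :=
  fun u v => 0 < A v u.

Definition directed_path (R : realType) (n : nat) (A : 'M[R]_n)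
    (u v : 'I_n) : Prop :=
  exists s : seq 'I_n,
    [/\ path (link A) u s, last u s = v & uniq (u :: s)].

Definition has_directed_spanning_tree (R : realType) (n : nat)
    (A : 'M[R]_n) : Prop :=
  exists i0 : 'I_n, forall j : 'I_n, j != i0 -> directed_path A i0 j.

(* A class of mutually reachable agents; the path reduced to a single agent is
   allowed, so a component may be a singleton. *)
Definition strongly_connected_component (R : realType) (n : nat)
    (A : 'M[R]_n) (S : {set 'I_n}) : Prop :=
  S != finset.set0 /\
  forall u v : 'I_n, u \in S ->
    (v \in S <-> directed_path A u v /\ directed_path A v u).

Definition laplacian (R : realType) (n : nat) (A : 'M[R]_n) : 'M[R]_n :=
  diag_mx (\row_i \sum_j A i j) - A.

(* The agents are numbered block after block: [tagnat.Rank m k] is the k-th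
   agent of the m-th block, and [submxblock L m1 m2] is the block L^{m1,m2}. *)
Definition block_agents (M : nat) (ns : 'I_M -> nat) (m : 'I_M) :
    {set 'I_(\sum_(m < M) ns m)} :=
  [set tagnat.Rank m k | k : 'I_(ns m)]%SET.

Definition perron_frobenius_form (R : realType) (M : nat) (ns : 'I_M -> nat)
    (A : 'M[R]_(\sum_(m < M) ns m)) : Prop :=
  (forall m1 m2 : 'I_M, (m2 < m1)%N -> submxblock (laplacian A) m1 m2 = 0) /\
  (forall m : 'I_M, strongly_connected_component A (block_agents ns m)).

Definition sat (R : realType) (h s : R) : R :=
  if h <= s then h else if s <= - h then - h else s.

Definition sat_vec (R : realType) (p : nat) (h : R) (s : 'rV[R]_p) :
    'rV[R]_p := map_mx (sat h) s.

Definition protocol (R : realType) (n p : nat) (A : 'M[R]_n)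
    (x : 'I_n -> R -> 'rV[R]_p) (i : 'I_n) (t : R) : 'rV[R]_p :=
  - \sum_j laplacian A i j *: x j t.

(* Values of x at negative times are irrelevant: at t = 0 the derivative is
   the right derivative. *)
Definition is_trajectory (R : realType) (n p : nat) (A : 'M[R]_n) (h : R)
    (x : 'I_n -> R -> 'rV[R]_p) : Prop :=
  forall i : 'I_n,
    (e^-1 *: (x i e - x i 0) @[e --> 0^'+]
       --> sat_vec h (protocol A x i 0))%classic /\
    (forall t : R, 0 < t ->
       is_derive t 1 (x i) (sat_vec h (protocol A x i t))).

Definition global_consensus (R : realType) (n p : nat) (A : 'M[R]_n)
    (h : R) : Prop :=
  forall (x0 : 'I_n -> 'rV[R]_p) (x : 'I_n -> R -> 'rV[R]_p),
    is_trajectory A h x -> (forall i, x i 0 = x0 i) ->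
    forall i j : 'I_n, (x i t - x j t @[t --> +oo] --> (0 : 'rV[R]_p))%classic.

(* Main.v *)
Require Import Defs.
From HB Require Import structures.
From mathcomp Require Import all_boot all_order all_algebra.
From mathcomp Require Import all_classical all_reals all_analysis.
From mathcomp Require Import ring lra.
Import Order.TTheory GRing.Theory Num.Theory.
Import numFieldNormedType.Exports.
Local Open Scope ring_scope.

(** Saturation only ever slows the linear protocol down, and on a bounded set of
    states it does so by a factor bounded away from 0.  Since the saturation
    acts componentwise, each coordinate of a trajectory solves a scalar system
    x_i' = sat_h (sum_j a_ij (x_j - x_i)), and it is enough to contract the
    spread max_i x_i - min_i x_i of such a system.

    - Maximum principle ([flow_le], [flow_ge]): an agent holding the maximal
      value has a nonpositive input, so an interval that contains all the
      states at one time contains them for ever.  The spread is therefore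
      bounded, and so are the inputs, say by K; on [0, K] the saturation is
      at least h / (h + K) times its argument ([sat_slope_ge]).

    - Propagation ([path_gain]): let y be a flow with values in [0, D].  With d
      above all row sums of the weights, [drift_ge] gives
      y_i' >= c a_ik y_k - d y_i with c = h / (h + d D).  By Gronwall, y_k stays
      above exp (- d) times its present value for one unit of time, at the end of
      which each out-neighbour i of k lies above a fixed multiple of that
      value.  Composing along directed paths issued from the root r of the
      spanning tree, y_i (s + n) >= g y_r (s) for all agents i, where g in
      ]0, 1[ depends on the graph, h and D only ([root_gain]).

    - Contraction ([spread_contraction]): if all states lie in [a, b] at time s,
      both x - a and b - x are flows as above.  Their values at the root add up
      to b - a, so n units of time later the states lie in an interval of
      length at most (1 - g) (b - a).  Iterating, the spread tends to 0
      geometrically ([flow_consensus]). *)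

Set Implicit Arguments.
Unset Strict Implicit.
Unset Printing Implicit Defensive.

(** * The scalar saturated system *)

(** The equation is asked for at positive times only: consensus is a statement
    at infinity, so that everything can be started at time 1, where derivatives
    are two-sided. *)
Definition saturated_flow (R : realType) (n : nat) (A : 'M[R]_n) (h : R)
    (x : 'I_n -> R -> R) : Prop :=
  forall i (t : R), 0 < t ->
    is_derive t 1 (x i : R -> R) (sat h (\sum_j A i j * (x j t - x i t))).

(** * Elementary bounds on the saturation *)

Lemma satN (R : realType) (h u : R) : 0 < h -> sat h (- u) = - sat h u.
Proof.
move=> h0; rewrite /sat.
case: (lerP h (- u)) => a; case: (lerP h u) => b;
  case: (lerP (- u) (- h)) => c; case: (lerP u (- h)) => e; lra.
Qed.

Lemma sat_le0 (R : realType) (h u : R) : 0 < h -> u <= 0 -> sat h u <= 0.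
Proof.
move=> h0 u0; rewrite /sat.
by case: (lerP h u) => a; case: (lerP u (- h)) => b; lra.
Qed.

Lemma ge_sat (R : realType) (h u : R) : 0 < h -> u <= 0 -> u <= sat h u.
Proof.
move=> h0 u0; rewrite /sat.
by case: (lerP h u) => a; case: (lerP u (- h)) => b; lra.
Qed.

(** The factor min (1, h / K) would be sharp; h / (h + K) lies below it
    and covers K = 0 without a case distinction. *)
Lemma sat_slope_ge (R : realType) (h K u : R) :
  0 < h -> 0 <= u <= K -> h / (h + K) * u <= sat h u.
Proof.
move=> h0 /andP[u0 uK].
have hK : 0 < h + K by lra.
rewrite mulrAC ler_pdivrMr // /sat.
by case: (lerP h u) => a; [|case: (lerP u (- h)) => b]; nra.
Qed.

(** * Symmetries and the maximum principle *)

(** Only differences of states enter the equation, and the saturation is odd: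
    this reduces lower bounds on states to upper bounds, and bounds relative to
    an arbitrary level to bounds relative to 0. *)
Lemma flow_reflect (R : realType) (n : nat) (A : 'M[R]_n) (h b : R) x :
  0 < h -> saturated_flow A h x -> saturated_flow A h (fun i t => b - x i t).
Proof.
move=> h0 fx i t t0; have dx := fx i t t0.
apply: (is_derive_eq (is_deriveB (is_derive_cst b t (1 : R)) dx)).
rewrite sub0r -satN // -sumrN; congr (sat h _).
by apply: eq_bigr => j _; ring.
Qed.

Lemma flow_shift (R : realType) (n : nat) (A : 'M[R]_n) (h a : R) x :
  0 < h -> saturated_flow A h x -> saturated_flow A h (fun i t => x i t - a).
Proof.
move=> h0 fx i t t0; have dx := fx i t t0.
apply: (is_derive_eq (is_deriveB dx (is_derive_cst a t (1 : R)))).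
by rewrite subr0; congr (sat h _); apply: eq_bigr => j _; ring.
Qed.

(** All difference quotients from the left are nonnegative. *)
Lemma derive_ge0_at_right_max (R : realType) (f : R -> R) (a c df : R) :
  a < c -> is_derive c 1 f df -> (forall t, a <= t <= c -> f t <= f c) ->
  0 <= df.
Proof.
move=> ac fc cmax; have [dfc <-] := fc.
rewrite ['D_1 f c]cvg_at_leftE //; apply: limr_ge.
  rewrite -(cvg_at_leftE (fun h : R => h^-1 *: ((f \o shift c) _ - f c))) //.
  apply: cvg_trans dfc; apply: cvg_app.
  by move=> S [e egt0 Se]; exists e => // x xe xgt0; apply: Se => //; exact/ltr0_neq0.
near=> e.
have e0 : e < 0 by near: e; exact: nbhs_left_lt.
have ae : a - c < e by near: e; apply: nbhs_left_gt; rewrite subr_lt0.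
apply: mulr_le0; first by rewrite invr_le0 ltW.
by rewrite subr_le0 [_%:A]mulr1; apply: cmax => /=; lra.
Unshelve. all: by end_near. Qed.

(** Tilt the states to x_j(u) - e' u with a small e' > 0 and maximize over the
    agents j and the times u in [s, t].  A maximum at a time c > s would have a
    nonnegative derivative there; but the input of the maximizing agent is
    nonpositive, so its tilted state decreases at rate at least e'.  The
    maximum is thus attained at time s, and e' tends to 0. *)
Lemma flow_le (R : realType) (n : nat) (A : 'M[R]_n) (h : R) x (s b : R) :
  weighted_digraph A -> 0 < h -> saturated_flow A h x -> 0 < s ->
  (forall i, x i s <= b) -> forall i t, s <= t -> x i t <= b.
Proof.
move=> [A0 _] h0 fx s0 xsb i t st; apply/ler_addgt0Pr => e e0.
(* The 1 keeps the denominator positive when t = s. *)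
have [e' e'0 e'le] : exists2 e', 0 < e' & e' * (t - s) <= e.
  exists (e / (1 + (t - s))); first by rewrite divr_gt0 //; lra.
  by rewrite mulrAC ler_pdivrMr; nra.
pose w j u := x j u - e' * u.
have dw j (u : R) : 0 < u -> is_derive u 1 (w j : R -> R)
    (sat h (\sum_k A j k * (x k u - x j u)) - e').
  move=> u0; have dx := fx j u u0.
  apply: (is_derive_eq (is_deriveB dx (is_deriveZ e' (is_derive_id u (1 : R))))).
  by rewrite /= [_ *: _]mulr1.
have wmax j : exists c, s <= c <= t /\ forall u, s <= u <= t -> w j u <= w j c.
  have [|c cst cmax] := @EVT_max _ (w j) _ _ st.
    apply: derivable_within_continuous => u; rewrite in_itv /= => /andP[su _].
    by have [] := dw j u (lt_le_trans s0 su).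
  by exists c; split.
have {}wmax j := cid (wmax j).
pose c j := projT1 (wmax j).
have [j _ jmax] := @arg_maxP _ _ 'I_n i predT (fun j => w j (c j)) isT.
have [/andP[scj cjt] cjmax] := projT2 (wmax j); rewrite -/(c j) in scj cjt cjmax.
have wle k u : s <= u <= t -> w k u <= w j (c j).
  move=> sut; have [_ ckmax] := projT2 (wmax k).
  exact: le_trans (ckmax u sut) (jmax k isT).
have [sc|sc] := ltP s (c j); last first.
  have csE : c j = s by lra.
  have := wle i t; rewrite st lexx csE /w => /(_ isT).
  have := xsb j; lra.
have : 0 <= sat h (\sum_k A j k * (x k (c j) - x j (c j))) - e'.
  apply: derive_ge0_at_right_max sc (dw _ _ (lt_le_trans s0 scj)) _ => u /andP[su uc].
  by apply: cjmax; rewrite su (le_trans uc).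
have : sat h (\sum_k A j k * (x k (c j) - x j (c j))) <= 0.
  apply: sat_le0 => //; apply: sumr_le0 => k _; apply: mulr_ge0_le0 => //.
  by have := wle k (c j); rewrite scj cjt /w => /(_ isT); lra.
lra.
Qed.

Lemma flow_ge (R : realType) (n : nat) (A : 'M[R]_n) (h : R) x (s a : R) :
  weighted_digraph A -> 0 < h -> saturated_flow A h x -> 0 < s ->
  (forall i, a <= x i s) -> forall i t, s <= t -> a <= x i t.
Proof.
move=> wA h0 fx s0 xsa i t st.
have := @flow_le _ _ A h (fun i t => 0 - x i t) s (- a) wA h0 (flow_reflect 0 h0 fx) s0.
move=> /(_ _ i t st) H; suff : 0 - x i t <= - a by lra.
by apply: H => j; have := xsa j; lra.
Qed.

(** * Propagation of positivity along links *)

(** The bound f' >= beta - d f says exactly that exp (d u) (f u - beta / d) is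
    nondecreasing in u. *)
Lemma gronwall_ge (R : realType) (f df : R -> R) (d beta s t : R) :
  0 < d -> s <= t ->
  (forall u, s <= u <= t -> is_derive u 1 f (df u)) ->
  (forall u, s <= u <= t -> beta - d * f u <= df u) ->
  expR (- (d * (t - s))) * f s + (1 - expR (- (d * (t - s)))) * (beta / d)
    <= f t.
Proof.
move=> d0 st fE dfge.
pose g u := expR (d * u) * (f u - beta / d).
have dg (u : R) : s <= u <= t -> is_derive u 1 (g : R -> R)
    (expR (d * u) * (df u - (beta - d * f u))).
  move=> sut; have dfu := fE u sut.
  have dE : is_derive u 1 (fun u => expR (d * u)) (expR (d * u) * d).
    apply: (is_derive_eq (is_derive1_comp (is_derive_expR (d * u))
      (is_deriveZ d (is_derive_id u (1 : R))))).
    by rewrite [_ *: _]mulr1.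
  apply: (is_derive_eq (is_deriveM dE (is_deriveB dfu (is_derive_cst (beta / d) u (1 : R))))).
  rewrite /= subr0 /GRing.scale /=.
  have -> : ((f - cst (beta / d)) u) = f u - beta / d by [].
  by field; lra.
have gle : g s <= g t.
  have dg' (u : R) : u \in `]s, t[%R -> s <= u <= t.
    by rewrite in_itv /= => /andP[/ltW -> /ltW ->].
  apply: (@ger0_derive1_ndecr _ g s t) => //.
  - by move=> u /dg' /dg [].
  - move=> u /dg' sut; rewrite derive1E; have [_ ->] := dg u sut.
    by rewrite mulr_ge0 ?expR_ge0 // subr_ge0 dfge.
  - apply: derivable_within_continuous => u; rewrite in_itv /= => sut.
    by have [] := dg u sut.
have -> : expR (- (d * (t - s))) = expR (d * s) / expR (d * t).
  by rewrite -expRB; congr expR; ring.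
have Et := expR_gt0 (d * t).
rewrite -subr_ge0 -(pmulr_rge0 _ Et); move: gle; rewrite /g -subr_ge0.
congr (_ <= _); field; lra.
Qed.

(** Any common bound on the row sums would do; the 1 makes it positive even for
    a graph without links, so that one may divide by it. *)
Definition decay_rate (R : realType) (n : nat) (A : 'M[R]_n) : R :=
  1 + \sum_i \sum_j A i j.

Lemma decay_rate_gt0 (R : realType) (n : nat) (A : 'M[R]_n) :
  weighted_digraph A -> 0 < decay_rate A.
Proof.
move=> [A0 _]; rewrite /decay_rate ltr_pwDl //.
by apply: sumr_ge0 => i _; apply: sumr_ge0.
Qed.

Lemma row_sum_le_decay_rate (R : realType) (n : nat) (A : 'M[R]_n) i :
  weighted_digraph A -> \sum_j A i j <= decay_rate A.
Proof.
move=> [A0 _]; rewrite /decay_rate [X in _ <= 1 + X](bigD1 i) //=.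
have : 0 <= \sum_(k | k != i) \sum_j A k j.
  by apply: sumr_ge0 => k _; apply: sumr_ge0.
lra.
Qed.

(** The input is P - q y_i with P = sum_j a_ij y_j >= a_ik y_k and
    q = sum_j a_ij.  If it is negative, the saturation does not lower it; if it
    is nonnegative, it is at most q D and [sat_slope_ge] applies, the loss of
    slope on the term - q y_i being favourable. *)
Lemma drift_ge (R : realType) (n : nat) (A : 'M[R]_n) (h D : R)
    (y : 'I_n -> R) i k :
  weighted_digraph A -> 0 < h -> (forall j, 0 <= y j <= D) ->
  h / (h + decay_rate A * D) * A i k * y k - decay_rate A * y i
    <= sat h (\sum_j A i j * (y j - y i)).
Proof.
move=> wA h0 yD; have [A0 _] := wA.
have d0 := decay_rate_gt0 wA; have qd := row_sum_le_decay_rate i wA.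
set d := decay_rate A in d0 qd *; set q := \sum_j A i j in qd.
have q0 : 0 <= q by apply: sumr_ge0.
have yk := yD k; have yi := yD i.
have y0 j : 0 <= y j by have /andP[] := yD j.
have -> : \sum_j A i j * (y j - y i) = \sum_j A i j * y j - q * y i.
  by rewrite mulr_suml -sumrB; apply: eq_bigr => j _; rewrite mulrBr.
set P := \sum_j _.
have PA : A i k * y k <= P.
  rewrite /P (bigD1 k) //= lerDl; apply: sumr_ge0 => j _; exact: mulr_ge0.
have PD : P <= q * D.
  rewrite /P /q mulr_suml; apply: ler_sum => j _; apply: ler_wpM2l => //.
  by have /andP[] := yD j.
have D0 : 0 <= D by case/andP: yk => /le_trans; apply.
have hd : 0 < h + d * D by have := mulr_ge0 (ltW d0) D0; lra.
have qy : q * y i <= d * y i by apply: ler_wpM2r.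
have qy0 : 0 <= q * y i by apply: mulr_ge0.
have Ay0 : 0 <= A i k * y k by apply: mulr_ge0.
have qD : q * D <= d * D by apply: ler_wpM2r.
set c := h / (h + d * D).
have c0 : 0 < c by rewrite divr_gt0.
have c1 : c <= 1 by rewrite ler_pdivrMr //; have := mulr_ge0 (ltW d0) D0; lra.
rewrite -mulrA.
have cA : c * (A i k * y k) <= A i k * y k by rewrite ler_piMl.
have [u0|u0] := lerP (P - q * y i) 0; first by have := ge_sat h0 u0; lra.
have : 0 <= P - q * y i <= d * D by apply/andP; split; lra.
move=> /(sat_slope_ge h0); rewrite -/c mulrBr.
have : c * (A i k * y k) <= c * P by apply: ler_wpM2l => //; exact: ltW.
have : c * (q * y i) <= q * y i by rewrite ler_piMl.
lra.
Qed.

(** [drift_ge] with k = i discards the help of the neighbours. *)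
Lemma flow_decay (R : realType) (n : nat) (A : 'M[R]_n) (h : R) y (s t : R) i :
  weighted_digraph A -> 0 < h -> saturated_flow A h y -> 0 < s -> s <= t ->
  (forall j, 0 <= y j s) ->
  expR (- (decay_rate A * (t - s))) * y i s <= y i t.
Proof.
move=> wA h0 fy s0 st ys; have [A0 _] := wA.
have d0 := decay_rate_gt0 wA.
(* [drift_ge] needs some upper bound on the states; the decay rate obtained
   does not depend on it. *)
pose D := \sum_j y j s.
have yD j : y j s <= D by rewrite /D (bigD1 j) //= lerDl; exact: sumr_ge0.
have yb u : s <= u -> forall j, 0 <= y j u <= D.
  move=> su j; rewrite (flow_ge wA h0 fy s0 ys j su) /=.
  exact: flow_le wA h0 fy s0 yD j u su.
have := @gronwall_ge _ (y i) _ (decay_rate A) 0 s t d0 st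
  (fun u sut => fy i u (lt_le_trans s0 (andP sut).1)).
rewrite mul0r mulr0 addr0; apply => u /andP[su _].
have := drift_ge i i wA h0 (yb u su).
suff : 0 <= h / (h + decay_rate A * D) * A i i * y i u by lra.
have /andP[yiu _] := yb u su i.
have D0 : 0 <= D by exact: sumr_ge0.
by rewrite !mulr_ge0 // ?invr_ge0 ?addr_ge0 ?mulr_ge0 // ltW.
Qed.

(** During [s, s + 1] the sender k keeps at least exp (- d) y_k(s) by
    [flow_decay], hence pushes its receiver i with the constant drift
    c y_k(s). *)
Lemma link_gain (R : realType) (n : nat) (A : 'M[R]_n) (h D : R) k i :
  weighted_digraph A -> 0 < h -> 0 <= D -> link A k i ->
  exists2 g, 0 < g & forall y (s : R), saturated_flow A h y -> 0 < s ->
    (forall j, 0 <= y j s <= D) -> g * y k s <= y i (s + 1).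
Proof.
move=> wA h0 D0 Aik; have d0 := decay_rate_gt0 wA.
set d := decay_rate A in d0 *.
pose c := h / (h + d * D) * A i k * expR (- d).
have c0 : 0 < c.
  rewrite !mulr_gt0 ?expR_gt0 // invr_gt0.
  by have := mulr_ge0 (ltW d0) D0; lra.
have e1 : expR (- d) < 1 by rewrite expR_lt1; lra.
exists ((1 - expR (- d)) * (c / d)); first by rewrite mulr_gt0 ?divr_gt0 ?subr_gt0.
move=> y s fy s0 ysD.
have ys j : 0 <= y j s by have /andP[] := ysD j.
have yb u : s <= u -> forall j, 0 <= y j u <= D.
  move=> su j; rewrite (flow_ge wA h0 fy s0 ys j su) /=.
  apply: flow_le wA h0 fy s0 _ j u su => k'; by have /andP[] := ysD k'.
have ss1 : s <= s + 1 by lra.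
have := @gronwall_ge _ (y i) _ d (c * y k s) s (s + 1) d0 ss1
  (fun u sut => fy i u (lt_le_trans s0 (andP sut).1)).
have -> : d * (s + 1 - s) = d by ring.
move=> H; have {H} : expR (- d) * y i s + (1 - expR (- d)) * (c * y k s / d) <= y i (s + 1).
  apply: H => u /andP[su us]; have := drift_ge i k wA h0 (yb u su); rewrite -/d.
  suff : c * y k s <= h / (h + d * D) * A i k * y k u by lra.
  rewrite /c -mulrA; apply: ler_wpM2l.
    by rewrite !mulr_ge0 ?invr_ge0 ?addr_ge0 ?mulr_ge0 // ltW.
  apply: le_trans (flow_decay k wA h0 fy s0 su ys).
  by apply: ler_wpM2r => //; rewrite ler_expR -/d; nra.
have -> : (1 - expR (- d)) * (c * y k s / d) = (1 - expR (- d)) * (c / d) * y k s by field; lra.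
have := mulr_ge0 (expR_ge0 (- d)) (ys i); lra.
Qed.

(** A path of length at most N is travelled in its own length, and [flow_decay]
    covers the remaining time at its end point.  The freedom in N lets all
    agents be reached at the same time. *)
Lemma path_gain (R : realType) (n : nat) (A : 'M[R]_n) (h D : R) k p N :
  weighted_digraph A -> 0 < h -> 0 <= D -> path (link A) k p ->
  (size p <= N)%N ->
  exists2 g, 0 < g & forall y (s : R), saturated_flow A h y -> 0 < s ->
    (forall j, 0 <= y j s <= D) -> g * y k s <= y (last k p) (s + N%:R).
Proof.
move=> wA h0 D0; elim: p k N => [|i p IH] k N /=.
  move=> _ _; exists (expR (- (decay_rate A * N%:R))); first exact: expR_gt0.
  move=> y s fy s0 ysD.
  have sN : s <= s + N%:R by rewrite lerDl.
  have -> : decay_rate A * N%:R = decay_rate A * (s + N%:R - s) by ring.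
  by apply: flow_decay wA h0 fy s0 sN _ => j; have /andP[] := ysD j.
case: N => // N /andP[ki ip] pN.
have [g1 g10 H1] := link_gain wA h0 D0 ki.
have [g2 g20 H2] := IH i N ip pN.
exists (g2 * g1); first exact: mulr_gt0.
move=> y s fy s0 ysD.
have -> : s + N.+1%:R = s + 1 + N%:R by rewrite -natr1; ring.
apply: le_trans (H2 y (s + 1) fy _ _); last 2 first.
- lra.
- move=> j; rewrite (@flow_ge _ _ A h y s) ?(@flow_le _ _ A h y s) //; try lra.
    by move=> l; have /andP[] := ysD l.
  by move=> l; have /andP[] := ysD l.
by rewrite -mulrA; apply: ler_wpM2l; [exact: ltW|exact: H1].
Qed.

(** A directed path has distinct agents, hence at most n - 1 links, so n units of
    time suffice for all targets. *)
Lemma root_gain (R : realType) (n : nat) (A : 'M[R]_n) (h D : R) r :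
  weighted_digraph A -> 0 < h -> 0 <= D ->
  (forall j, j != r -> directed_path A r j) ->
  exists2 g, 0 < g < 1 & forall y (s : R), saturated_flow A h y -> 0 < s ->
    (forall j, 0 <= y j s <= D) -> forall i, g * y r s <= y i (s + n%:R).
Proof.
move=> wA h0 D0 rt.
have gain i : exists2 g, 0 < g & forall y (s : R), saturated_flow A h y ->
    0 < s -> (forall j, 0 <= y j s <= D) -> g * y r s <= y i (s + n%:R).
  have [p [rp <- pn]] : exists p, [/\ path (link A) r p, last r p = i & (size p <= n)%N].
    have [->|/rt[p [rp pi pu]]] := eqVneq i r; first by exists [::].
    exists p; split => //; apply: ltnW.
    by rewrite -[n in (_ < n)%N]card_ord -[(size p).+1]/(size (r :: p)) -(card_uniqP pu) max_card.
  exact: path_gain.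
(* The bound persists when g decreases, so it holds for all small g, and
   finitely many such conditions can be met together. *)
have : \forall g \near at_right (0 : R), forall i y (s : R), saturated_flow A h y ->
    0 < s -> (forall j, 0 <= y j s <= D) -> g * y r s <= y i (s + n%:R).
  apply: filter_forall => i; have [g g0 gi] := gain i.
  near=> e => y s fy s0 ysD; apply: le_trans (gi y s fy s0 ysD).
  apply: ler_wpM2r; first by have /andP[] := ysD r.
  by near: e; exact: nbhs_right_le.
move=> Hg; near (at_right (0 : R)) => g; exists g.
  by apply/andP; split; near: g; [exact: nbhs_right_gt | exact: nbhs_right_lt].
by move=> y s fy s0 ysD i; apply: (near Hg g).
Unshelve. all: by end_near. Qed.

(** * Contraction of the spread and consensus *)

(** [root_gain] for x - a raises the lower end of the interval by
    g (x_r - a), and for b - x it lowers the upper end by g (b - x_r); the two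
    gains add up to g (b - a), wherever x_r lies. *)
Lemma spread_contraction (R : realType) (n : nat) (A : 'M[R]_n) (h D : R) :
  weighted_digraph A -> 0 < h -> has_directed_spanning_tree A -> 0 <= D ->
  exists2 g, 0 < g < 1 & forall x (s a b : R), saturated_flow A h x ->
    0 < s -> b - a <= D -> (forall i, a <= x i s <= b) ->
    exists a' b', b' - a' <= (1 - g) * (b - a) /\
      forall i, a' <= x i (s + n%:R) <= b'.
Proof.
move=> wA h0 [r rt] D0; have [g g01 gr] := root_gain wA h0 D0 rt.
exists g => // x s a b fx s0 baD xs.
exists (a + g * (x r s - a)), (b - g * (b - x r s)); split; first lra.
have up j : 0 <= b - x j s <= D by have := xs j; lra.
have lo j : 0 <= x j s - a <= D by have := xs j; lra.
move=> i; have := gr _ s (flow_shift a h0 fx) s0 lo i.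
by have := gr _ s (flow_reflect b h0 fx) s0 up i; lra.
Qed.

Lemma flow_consensus (R : realType) (n : nat) (A : 'M[R]_n) (h : R) x i j :
  weighted_digraph A -> 0 < h -> has_directed_spanning_tree A ->
  saturated_flow A h x -> forall e : R, 0 < e ->
  exists T : R, forall t, T <= t -> `|x i t - x j t| <= e.
Proof.
move=> wA h0 tA fx e e0; have [r _] := tA.
pose S := \sum_k `|x k 1 - x r 1|.
have xS k : `|x k 1 - x r 1| <= S.
  by rewrite /S (bigD1 k) //= lerDl; apply: sumr_ge0.
have S0 : 0 <= S by apply: sumr_ge0.
have D0 : 0 <= S + S by lra.
have [g g01 gc] := spread_contraction wA h0 tA D0.
(* 2 S bounds the spread at time 1; since the spread does not grow, the same
   g serves at every round. *)
have spread k : exists a b : R, b - a <= (1 - g) ^+ k * (S + S) /\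
    forall l, a <= x l (1 + (k * n)%:R) <= b.
  elim: k => [|k [a [b [ab xk]]]].
    exists (x r 1 - S), (x r 1 + S); rewrite mul0n addr0 expr0; split; first lra.
    by move=> l; have := xS l; rewrite ler_norml; lra.
  have q1 : (1 - g) ^+ k <= 1 by apply: exprn_ile1; lra.
  have [||a' [b' [ab' xk']]] := gc x (1 + (k * n)%:R) a b fx _ _ xk.
  - by rewrite ltr_pwDl.
  - by apply: le_trans ab _; rewrite ler_piMl.
  exists a', b'; rewrite mulSn addnC natrD addrA; split => //.
  apply: le_trans ab' _; rewrite exprS -mulrA; apply: ler_wpM2l => //; lra.
have [k ke] : exists k, (1 - g) ^+ k * (S + S) <= e.
  have q1 : `|1 - g| < 1 by rewrite ger0_norm; lra.
  have /cvgr0Pnorm_le/(_ e e0) [k _ kP] := cvg_geometric (S + S) q1.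
  exists k; have := kP k (leqnn k); rewrite /= /geometric /= mulrC.
  exact/le_trans/ler_norm.
have [a [b [ab xk]]] := spread k.
have k0 : (0 : R) < 1 + (k * n)%:R by rewrite ltr_pwDl.
exists (1 + (k * n)%:R) => t kt.
have lo l : a <= x l t.
  by apply: (flow_ge wA h0 fx k0 _ l kt) => l'; have /andP[] := xk l'.
have up l : x l t <= b.
  by apply: (flow_le wA h0 fx k0 _ l kt) => l'; have /andP[] := xk l'.
rewrite ler_norml; move: (lo i) (lo j) (up i) (up j); lra.
Qed.

(** * From trajectories to scalar flows *)

Lemma protocolE (R : realType) (n p : nat) (A : 'M[R]_n)
    (x : 'I_n -> R -> 'rV[R]_p) i t c :
  protocol A x i t ord0 c = \sum_j A i j * (x j t ord0 c - x i t ord0 c).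
Proof.
rewrite /protocol mxE summxE.
under eq_bigr => j _ do rewrite !mxE mulrBl.
rewrite sumrB; set q := \sum_j A i j.
rewrite (bigD1 i) //= eqxx mulr1n big1 ?addr0; last first.
  by move=> j ji; rewrite eq_sym (negPf ji) mulr0n mul0r.
by rewrite opprB mulr_suml -sumrB; apply: eq_bigr => j _; rewrite mulrBr.
Qed.

Lemma trajectory_coord (R : realType) (n p : nat) (A : 'M[R]_n) (h : R)
    (x : 'I_n -> R -> 'rV[R]_p) c :
  is_trajectory A h x -> saturated_flow A h (fun i t => x i t ord0 c).
Proof.
move=> xA i t t0; have [_ /(_ t t0) [dx xE]] := xA i.
apply: DeriveDef; first exact: (derivable_mxP _ _ _).1 dx ord0 c.
by move/rowP/(_ c): xE; rewrite derive_mx // mxE => ->; rewrite /sat_vec mxE protocolE.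
Qed.

Theorem theorem2 (R : realType) (M : nat) (ns : 'I_M -> nat) (p : nat)
    (A : 'M[R]_(\sum_(m < M) ns m)) (h : R) :
  weighted_digraph A ->
  0 < h ->
  has_directed_spanning_tree A ->
  perron_frobenius_form A ->
  global_consensus p A h.
Proof.
move=> wA h0 tA _ x0 x xA _ i j; apply/cvgr0Pnorm_le => e e0.
have : \forall t \near +oo, forall c, `|x i t ord0 c - x j t ord0 c| <= e.
  apply: filter_forall => c.
  have [T HT] := flow_consensus i j wA h0 tA (trajectory_coord c xA) e0.
  by near=> t; apply: HT; near: t; apply: nbhs_pinfty_ge; exact: num_real.
apply: filterS => t xe.
rewrite [leLHS]/Num.Def.normr /= mx_normrE (bigmax_le _ (ltW e0)) //= => -[k c] _.
by rewrite /= (ord1 k) !mxE; exact: xe.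
Unshelve. all: by end_near. Qed.
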